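(* Let $\mu$ be a non-zero $\sigma$-finite (countably additive non-negative) measure on a $\sigma$-algebra $\Sigma$ of subsets of a non-empty set $\Omega$. Then the real space $L_1(\mu)$ has property CWO-$S$.
   Context: $B_X$ and $S_X$ denote the closed unit ball and the unit sphere of a Banach space $X$. A finite convex combination of relatively weakly open subsets of $B_X$ is a set $C=\sum_{j=1}^n\lambda_jU_j=\{\sum_{j=1}^n\lambda_ju_j: u_j\in U_j\}$, where $n\in\mathbb N$, each $U_j\subset B_X$ is open in the relative weak topology of $B_X$, $\lambda_j>0$ and $\sum_{j=1}^n\lambda_j=1$. The space $X$ has property CWO-$S$ if, for every such $C$, every $x\in C\cap S_X$ is an interior point of $C$ in the relative weak topology of $B_X$. *)

(* Defs.v *)
From HB Require Import structures.
From mathcomp Require Import all_boot all_order all_algebra.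
From mathcomp Require Import all_classical all_reals all_analysis.
From mathcomp Require Import measurable_realfun ess_sup_inf.
Set Implicit Arguments.
Unset Strict Implicit.
Unset Printing Implicit Defensive.
Import Order.TTheory GRing.Theory Num.Theory.
Import numFieldNormedType.Exports.
Local Open Scope classical_set_scope.
Local Open Scope ring_scope.
Local Open Scope quotient_scope.
(* LspaceType carries no algebraic structure in the library. It is made here
   into a normed space over R: operations are induced by those of LfunType on
   representatives, and the norm of a class is the Lp-norm of any
   representative. *)
Section Lspace_normed.
Context d (T : measurableType d) (R : realType).
Variables (mu : {measure set T -> \bar R}) (p : \bar R) (p1 : (1 <= p)%E).
Local Notation Lf := (LfunType mu p1).
Local Notation Ls := (LspaceType mu p1).
Implicit Types (f g h : Lf) (x y z : Ls).

Let finite_norm_ae (f g : T -> R) :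
  measurable_fun setT f -> measurable_fun setT g ->
  f = g %[ae mu] -> ('N[mu]_p[EFin \o f] = 'N[mu]_p[EFin \o g])%E.
Proof.
move=> mf mg fg; rewrite unlock /Lnorm; case: p p1 => [r r1||//].
- congr (_ `^ _)%E; apply: ae_eq_integral => //=.
  + apply/measurable_EFinP; apply: (measurableT_comp (measurable_powR _)) => //.
    exact: measurableT_comp.
  + apply/measurable_EFinP; apply: (measurableT_comp (measurable_powR _)) => //.
    exact: measurableT_comp.
  + by apply: filterS fg => x /= h Dx; rewrite h.
- move=> _; case: ifPn => // _; apply: eq_ess_sup.
  by apply: filterS fg => x /= h; rewrite h.
Qed.

(* R and measurableTypeR R have the same measurable sets but different
   displays, so that measurability has to be transported by hand. *)
Section Lclass.
Variable f : Lf.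
Let mf : (f : T -> measurableTypeR R) \in mfun.
Proof. by rewrite inE; exact: (@measurable_funPT _ _ _ _ f). Qed.

Definition Lclass_ae : {mfun_ mu, T >-> measurableTypeR R} :=
  \pi_({mfun_ mu, T >-> measurableTypeR R}) (mfun_Sub mf).

Lemma Lclass_aeE : (Lclass_ae : T -> R) = f %[ae mu].
Proof.
rewrite /Lclass_ae /aqEqMfun_to_fun.
by case: piP => g /eqmodP /asboolP h; exact/ae_eq_sym.
Qed.

Let Lclass_fin : finite_norm mu p Lclass_ae.
Proof.
rewrite /finite_norm (_ : 'N[mu]_p[_] = 'N[mu]_p[EFin \o f])%E; last first.
  apply: finite_norm_ae.
  - exact: (@measurable_funPT _ _ _ _ (repr Lclass_ae)).
  - exact: measurable_funPT.
  - exact: Lclass_aeE.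
exact: Lfunction_finite.
Qed.
HB.instance Definition _ := isFinLebesgue.Build d T R mu p p1 Lclass_ae Lclass_fin.
Definition Lclass : Ls := [the Ls of Lclass_ae].
End Lclass.

Lemma LclassE f : (Lclass f : T -> R) = f %[ae mu].
Proof. exact: Lclass_aeE. Qed.

Lemma Lspace_Lfun x : (x : T -> R) \in Lfun mu p.
Proof.
apply/andP; split; last by rewrite inE; exact: Lebesgue_finite.
rewrite inE.
exact: (@measurable_funPT _ _ _ _
  (repr (x : {mfun_ mu, T >-> measurableTypeR R}))).
Qed.

Definition Lrepr x : Lf := Lfun_Sub p1 (Lspace_Lfun x).

Lemma LreprE x : (Lrepr x : T -> R) = x. Proof. by []. Qed.

Lemma Lspace_eqP x y : (x : T -> R) = y %[ae mu] <-> x = y.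
Proof.
split=> [xy|->]; last exact: ae_eq_refl.
have : LebesgueSpace.sort x = LebesgueSpace.sort y.
  rewrite -[LHS]reprK -[RHS]reprK; apply/eqmodP; exact/asboolP.
case: x {xy} => x [[hx]]; case: y => y [[hy]] /= xy.
by rewrite -xy in hy *; rewrite (Prop_irrelevance hx hy).
Qed.

Lemma Lclass_eqP f g : Lclass f = Lclass g <-> (f : T -> R) = g %[ae mu].
Proof.
rewrite -Lspace_eqP; split => fg.
- exact: ae_eq_trans (ae_eq_sym (LclassE f)) (ae_eq_trans fg (LclassE g)).
- exact: ae_eq_trans (LclassE f) (ae_eq_trans fg (ae_eq_sym (LclassE g))).
Qed.

Lemma LreprK : cancel Lrepr Lclass.
Proof. by move=> x; apply/Lspace_eqP; exact: LclassE. Qed.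

Lemma LclassK f : (Lrepr (Lclass f) : T -> R) = f %[ae mu].
Proof. exact: LclassE. Qed.

HB.instance Definition _ := gen_eqMixin Ls.
HB.instance Definition _ := gen_choiceMixin Ls.

Definition Lspace_zero : Ls := Lclass 0.
Definition Lspace_opp x : Ls := Lclass (- Lrepr x).
Definition Lspace_add x y : Ls := Lclass (Lrepr x + Lrepr y).
Definition Lspace_scale (a : R) x : Ls := Lclass (a *: Lrepr x).
Definition Lspace_norm x : R := fine 'N[mu]_p[EFin \o (x : T -> R)].

Let ae_add f f' g g' : (f : T -> R) = f' %[ae mu] -> (g : T -> R) = g' %[ae mu] ->
  (f + g : T -> R) = (f' + g')%R %[ae mu].
Proof.
move=> ff' gg'; apply: filterS2 ff' gg' => t /= ft gt Dt.
by rewrite /GRing.add/= ft// gt.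
Qed.

Let ae_scale a f f' : (f : T -> R) = f' %[ae mu] ->
  (a *: f : T -> R) = (a *: f')%R %[ae mu].
Proof. by apply: filterS => t /= ft Dt; rewrite /GRing.scale/= ft. Qed.

Lemma Lclass_add f g : Lclass (f + g) = Lspace_add (Lclass f) (Lclass g).
Proof. by apply/Lclass_eqP/ae_eq_sym; apply: ae_add; exact: LclassK. Qed.

Lemma Lclass_scale a f : Lclass (a *: f) = Lspace_scale a (Lclass f).
Proof. by apply/Lclass_eqP/ae_eq_sym; apply: ae_scale; exact: LclassK. Qed.

Let addA : associative Lspace_add.
Proof.
move=> x y z; rewrite -[x]LreprK -[y]LreprK -[z]LreprK.
by rewrite -!Lclass_add addrA.
Qed.

Let addC : commutative Lspace_add.
Proof. by move=> x y; rewrite /Lspace_add addrC. Qed.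

Let add0 : left_id Lspace_zero Lspace_add.
Proof. by move=> x; rewrite -[x]LreprK -Lclass_add add0r. Qed.

Let addN : left_inverse Lspace_zero Lspace_opp Lspace_add.
Proof.
move=> x; rewrite -[in X in Lspace_add _ X](LreprK x) /Lspace_opp.
by rewrite -Lclass_add addNr.
Qed.

HB.instance Definition _ := GRing.isZmodule.Build Ls addA addC add0 addN.

Let scaleA a b x : Lspace_scale a (Lspace_scale b x) = Lspace_scale (a * b) x.
Proof. by rewrite -[x]LreprK -!Lclass_scale scalerA. Qed.

Let scale1 : left_id 1 Lspace_scale.
Proof. by move=> x; rewrite -[x]LreprK -Lclass_scale scale1r. Qed.

Let scaleDr : right_distributive Lspace_scale +%R.
Proof.
move=> a x y; rewrite -[x]LreprK -[y]LreprK.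
by rewrite -[X in Lspace_scale _ X]Lclass_add -!Lclass_scale scalerDr Lclass_add.
Qed.

Let scaleDl x : {morph Lspace_scale^~ x : a b / a + b}.
Proof.
move=> a b; rewrite -[x]LreprK -!Lclass_scale scalerDl.
exact: Lclass_add.
Qed.

HB.instance Definition _ := GRing.Zmodule_isLmodule.Build R Ls
  scaleA scale1 scaleDr scaleDl.

Lemma Lspace_norm_class f : Lspace_norm (Lclass f) = fine 'N[mu]_p[EFin \o f].
Proof.
congr fine; apply: finite_norm_ae.
- exact: (@measurable_funPT _ _ _ _ (Lrepr (Lclass f))).
- exact: measurable_funPT.
- exact: LclassE.
Qed.

Let normD x y : Lspace_norm (x + y) <= Lspace_norm x + Lspace_norm y.
Proof. by rewrite [Lspace_norm (x + y)]Lspace_norm_class; exact: ler_LnormD. Qed.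

Let normZ a x : Lspace_norm (a *: x) = `|a| * Lspace_norm x.
Proof.
rewrite [LHS]Lspace_norm_class; apply: EFin_inj.
rewrite finite_norm_fine EFinM [(Lspace_norm x)%:E](finite_norm_fine (Lrepr x)).
exact: LnormZ.
Qed.

Let norm0_eq0 x : Lspace_norm x = 0 -> x = 0.
Proof.
move=> /(@fine_Lnormr_eq0 _ _ _ _ _ _ (Lrepr x)) x0.
by rewrite -[x]LreprK; apply/Lclass_eqP.
Qed.

HB.instance Definition _ := Lmodule_isNormed.Build R Ls normD normZ norm0_eq0.

End Lspace_normed.
Section weak_topology_of_normed_space.
Variables (R : realType) (V : normedModType R).

(* V with the coarsest topology making every norm-continuous linear functional
   continuous *)
Definition weak_space : Type :=
  @sup_topology V {f : {linear V -> R^o} | continuous (f : V -> R^o)}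
    (fun f => Topological.class (initial_topology (sval f : V -> R^o))).

HB.instance Definition _ := Topological.on weak_space.

Definition unit_ball : set V := [set x | `|x| <= 1].

Definition unit_sphere : set V := [set x | `|x| = 1].

(* In subspace B every set disjoint from B is open, so that relative openness
   in B is only meaningful together with inclusion in B. *)
Definition weak_ball : topologicalType :=
  subspace (unit_ball : set weak_space).

Definition relatively_weakly_open (U : set V) : Prop :=
  U `<=` unit_ball /\ open (U : set weak_ball).

Definition relative_weak_interior (C : set V) : set V :=
  interior (C : set weak_ball).

Definition convex_combination_of_sets (n : nat) (lambda : 'I_n -> R)
    (U : 'I_n -> set V) : set V :=
  [set \sum_(j < n) lambda j *: u j | u in [set u | forall j, U j (u j)]].

Definition CWO_S : Prop :=
  forall (n : nat) (lambda : 'I_n -> R) (U : 'I_n -> set V),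
    (forall j, 0 < lambda j) -> \sum_(j < n) lambda j = 1 ->
    (forall j, relatively_weakly_open (U j)) ->
    convex_combination_of_sets lambda U `&` unit_sphere
      `<=` relative_weak_interior (convex_combination_of_sets lambda U).

End weak_topology_of_normed_space.

(* Main.v *)
From HB Require Import structures.
Require Import Defs.
From mathcomp Require Import all_boot all_order all_algebra.
From mathcomp Require Import all_classical all_reals all_analysis.
From mathcomp Require Import measurable_realfun ring lra.
Set Implicit Arguments.
Unset Strict Implicit.
Unset Printing Implicit Defensive.
Import Order.TTheory GRing.Theory Num.Theory.
Import numFieldNormedType.Exports.
Local Open Scope classical_set_scope.
Local Open Scope ring_scope.

(** Let [x = \sum_j l_j u_j] have norm 1, with each [u_j] in the unit ball of
    L1.  Equality in the triangle inequality forces the [u_j] to have, almost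
    everywhere, the sign of [x] ([norming_sign]).  Hence [u_j = g_j x] with
    [g_j = |u_j| / \sum_i l_i |u_i|], where [0 <= g_j <= 1 / l_j] and
    [\sum_j l_j g_j = 1].  Multiplication by [g_j] is a bounded operator [M_j],
    so it is weakly continuous, and every [y] decomposes as
    [y = \sum_j l_j M_j y] with [\sum_j l_j |M_j y| = |y|] ([L1_splitting]).
    When [y] tends weakly to [x] inside the ball, [M_j y] tends weakly to
    [u_j], so [M_j y] would lie in [U_j] were it not for its norm, which may
    slightly exceed 1.

    The norms do converge to 1: the functional [phi] of integration against
    the sign of [x] has norm one and takes the value 1 at [x], hence at all
    [u_j].  So [phi (M_j y)] tends to 1 and bounds [|M_j y|] from below, while
    the identity [\sum_j l_j |M_j y| = |y| <= 1] turns these lower bounds into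
    upper ones.  It remains to bring all the pieces into the ball without
    changing their weighted sum.  With [D] at least every excess [|M_j y| - 1]
    and tending to 0, each piece is shrunk by [1 / (1 + D)], and the missing
    part of [y] is given back as multiples of [y], each piece receiving an
    amount proportional to the room left for it in the ball ([rebalance]).
    Since the average norm of the pieces is at most 1, there is enough room.
    The corrections vanish in the limit, so [y] is a combination of points of
    the [U_j] as soon as it is weakly close to [x] ([CWO_S_of_splitting]). *)

(** * Convex combinations of numbers and shares *)

Lemma convex_comb_eq1 (R : realType) n (l a : 'I_n -> R) :
  (forall j, 0 < l j) -> \sum_(j < n) l j = 1 -> (forall j, a j <= 1) ->
  \sum_(j < n) l j * a j = 1 -> forall j, a j = 1.
Proof.
move=> l0 l1 a1 la1 j.
have s0 : \sum_(i < n) l i * (1 - a i) = 0.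
  by under eq_bigr do rewrite mulrBr mulr1; rewrite sumrB l1 la1 subrr.
have := s0 => /psumr_eq0P /(_ j isT)/eqP.
rewrite mulf_eq0 gt_eqF//= => h; apply/eqP; rewrite eq_sym -subr_eq0 h//.
by move=> i _; rewrite mulr_ge0 ?subr_ge0// ltW.
Qed.

Section share.
Context {R : realType} {n : nat}.
Implicit Types (l a w : 'I_n -> R).

(** The value 1 for a vanishing total keeps the [l]-weighted sum of the shares
    equal to 1, as [\sum_j l_j = 1]. *)
Definition share l a j : R :=
  if \sum_(i < n) l i * a i == 0 then 1 else a j / \sum_(i < n) l i * a i.

Lemma share_ge0 l a j : (forall i, 0 < l i) -> (forall i, 0 <= a i) ->
  0 <= share l a j.
Proof.
move=> l0 a0; rewrite /share; case: ifP => // _; rewrite divr_ge0// sumr_ge0// => i _.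
by rewrite mulr_ge0// ltW.
Qed.

Lemma sum_share l a : \sum_(j < n) l j = 1 -> \sum_(j < n) l j * share l a j = 1.
Proof.
move=> l1; have [S0|S0] := eqVneq (\sum_(i < n) l i * a i) 0.
  by rewrite -[RHS]l1; apply: eq_bigr => j _; rewrite /share S0 eqxx mulr1.
rewrite -(divff S0) mulr_suml.
by apply: eq_bigr => j _; rewrite /share (negPf S0) mulrA.
Qed.

Lemma share_le l a j : (forall i, 0 < l i) -> (forall i, 0 <= a i) ->
  \sum_(i < n) l i = 1 -> share l a j <= (l j)^-1.
Proof.
move=> l0 a0 l1; rewrite -[leRHS]mul1r ler_pdivlMr// mulrC -(sum_share a l1).
rewrite (bigD1 j)//= lerDl sumr_ge0// => i _.
by rewrite mulr_ge0 ?share_ge0// ltW.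
Qed.

(** Numbers of a common sign [s] add up without cancellation: the weighted sum
    of the [w_i] is [s] times the total of the [a_i], and if it vanishes then so
    does every [w_j]. *)
Lemma share_sum l a w (s : R) j : (forall i, 0 < l i) -> (forall i, 0 <= a i) ->
  (forall i, a i = s * w i) -> s * s = 1 ->
  share l a j * \sum_(i < n) l i * w i = w j.
Proof.
move=> l0 a0 aw ss.
have wa i : w i = s * a i by rewrite aw mulrA ss mul1r.
rewrite (eq_bigr (fun i => s * (l i * a i))); last by move=> i _; rewrite wa mulrCA.
rewrite -mulr_sumr /share; case: ifPn => [/eqP S0|S0].
  have /eqP := psumr_eq0P (fun i _ => mulr_ge0 (ltW (l0 i)) (a0 i)) S0 (isT : xpredT j).
  by rewrite mulf_eq0 gt_eqF//= wa S0 => /eqP ->; rewrite !mulr0.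
by rewrite mulrCA divfK// wa.
Qed.

End share.

(** * The weak topology of the unit ball *)

Section weak.
Context {R : realType} {V : normedModType R}.

(** Testing on functionals reduces every weak limit below to limits of real
    functions. *)
Lemma weak_cvgP (F : set_system V) (x : V) : Filter F ->
  (F --> (x : weak_space V)) <->
  forall f : {linear V -> R^o}, continuous (f : V -> R^o) -> f @ F --> f x.
Proof.
move=> FF; rewrite cvg_sup; split => [h f cf|h [f cf]].
- move=> U; rewrite nbhsE => -[B [oB Bx] BU].
  have := h (exist _ f cf) (f @^-1` B).
  rewrite /= => h1; rewrite /nbhs/=; apply: (@filterS _ _ _ (f @^-1` B)); first by move=> z /BU.
  apply: h1; have /= -> := @nbhsE (initial_topology (f : V -> R^o)) x.
  by exists (f @^-1` B) => //; split => //; exists B.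
- move=> U; have /= -> := @nbhsE (initial_topology (f : V -> R^o)) x.
  case=> B [[C oC <- Cx]] /filterS; apply; apply: h => //.
  by apply: open_nbhs_nbhs.
Qed.

Lemma nbhs_weak_ball (x : V) : `|x| <= 1 ->
  nbhs (x : weak_ball V) = within (@unit_ball R V) (nbhs (x : weak_space V)).
Proof. by move=> x1; exact: esym (@nbhs_subspace_in (weak_space V) _ _ x1). Qed.

(** * Bringing the pieces of a decomposition into the unit ball *)

(** A piece [v] of [y], of norm at most [1 + D], is shrunk by [1 / (1 + D)] and
    receives a multiple of [y].  The first factor of the coefficient is the
    room left in the unit ball; the second is the ratio for which the total
    given back is the [D / (1 + D)] part of [y] removed by the shrinking.  The
    denominator [1 + D - |y|] vanishes only for [D = 0] and [|y| = 1], when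
    there is nothing to give back and the quotient is 0. *)
Definition rebalance (D : R) (v y : V) : V :=
  (1 + D)^-1 *: v + ((1 - `|v| / (1 + D)) * (D / (1 + D - `|y|))) *: y.

Lemma rebalance_weight (D : R) (y : V) : 0 <= D -> `|y| <= 1 ->
  0 <= D / (1 + D - `|y|) <= 1.
Proof.
move=> D0 y1; have h : 0 <= 1 + D - `|y| by lra.
rewrite divr_ge0//=; move: h; rewrite le_eqVlt => /predU1P[<-|h].
  by rewrite invr0 mulr0.
by rewrite ler_pdivrMr// mul1r; lra.
Qed.

(** The multiple of [y] is at most the room left, because [y] is in the ball and
    the ratio is at most 1. *)
Lemma norm_rebalance (D : R) (v y : V) :
  0 <= D -> `|v| <= 1 + D -> `|y| <= 1 -> `|rebalance D v y| <= 1.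
Proof.
move=> D0 vD y1; have /andP[t0 t1] := rebalance_weight D0 y1.
have d0 : 0 < 1 + D by lra.
have m1 : `|v| / (1 + D) <= 1 by rewrite ler_pdivrMr// mul1r.
have c0 : 0 <= (1 - `|v| / (1 + D)) * (D / (1 + D - `|y|)).
  by rewrite mulr_ge0 ?subr_ge0.
rewrite (le_trans (ler_normD _ _))// normrZ [X in _ + X]normrZ (ger0_norm c0).
rewrite ger0_norm ?invr_ge0 ?(ltW d0)//.
rewrite [_^-1 * _]mulrC addrC -lerBrDr -mulrA ler_piMr ?subr_ge0//.
by rewrite mulr_ile1.
Qed.

(** The rooms have weighted average [1 - |y| / (1 + D)] because the norms of the
    pieces add up to that of [y]; times the ratio this is [D / (1 + D)]. *)
Lemma sum_rebalance n (l : 'I_n -> R) (v : 'I_n -> V) (y : V) (D : R) :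
  0 <= D -> `|y| <= 1 -> \sum_(j < n) l j = 1 ->
  \sum_(j < n) l j *: v j = y -> \sum_(j < n) l j * `|v j| = `|y| ->
  \sum_(j < n) l j *: rebalance D (v j) y = y.
Proof.
move=> D0 y1 l1 lv lnv; have d0 : 0 < 1 + D by lra.
pose t := D / (1 + D - `|y|).
rewrite (eq_bigr (fun j => (1 + D)^-1 *: (l j *: v j) +
    ((l j - l j * `|v j| / (1 + D)) * t) *: y)); last first.
  move=> j _; rewrite scalerDr !scalerA (mulrC (l j) (1 + D)^-1) -/t.
  by congr (_ + _ *: _); ring.
rewrite big_split/= -scaler_sumr lv -scaler_suml -scalerDl.
rewrite -[RHS]scale1r; congr (_ *: _).
rewrite -mulr_suml sumrB l1 -mulr_suml lnv /t.
have [e|e] := eqVneq (1 + D - `|y|) 0.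
  have -> : D = 0 by lra.
  by rewrite addr0 mul0r mulr0 invr1 addr0.
by field; rewrite e gt_eqF.
Qed.

(** The shrinking factor tends to 1, and the coefficient of [y] lies between 0
    and the room [1 - |v| / (1 + D)], which tends to 0. *)
Lemma rebalance_cvg (F : set_system V) (FF : Filter F) (D : V -> R)
    (v : V -> V) (x u : V) :
  (\forall y \near F, `|y| <= 1) ->
  (\forall y \near F, 0 <= D y) -> (\forall y \near F, `|v y| <= 1 + D y) ->
  D @ F --> (0 : R) -> (fun y => `|v y|) @ F --> (1 : R) ->
  F --> (x : weak_space V) -> v @ F --> (u : weak_space V) ->
  (fun y => rebalance (D y) (v y) y) @ F --> (u : weak_space V).
Proof.
move=> B D0 vD Dc vc /weak_cvgP xc /weak_cvgP uc.
apply/weak_cvgP => f cf.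
have dc : (fun y => (1 + D y)^-1) @ F --> (1 : R).
  rewrite [X in _ --> X](_ : _ = (1 + 0)^-1); last by rewrite addr0 invr1.
  apply: cvgV; first by rewrite addr0 oner_neq0.
  by apply: cvgD => //; exact: cvg_cst.
pose c y := (1 - `|v y| / (1 + D y)) * (D y / (1 + D y - `|y|)).
have cc : c @ F --> (0 : R).
  apply: (@squeeze_cvgr _ _ _ _ (cst 0) (fun y => 1 - `|v y| / (1 + D y))).
  - near=> y.
    have y1 : `|y| <= 1 by near: y.
    have d0 : 0 <= D y by near: y.
    have /andP[t0 t1] := rebalance_weight d0 y1.
    have e0 : 0 < 1 + D y by lra.
    have m1 : 0 <= 1 - `|v y| / (1 + D y).
      by rewrite subr_ge0 ler_pdivrMr// mul1r; near: y.
    by rewrite /c mulr_ge0//= ler_piMr.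
  - exact: cvg_cst.
  - rewrite -[X in _ --> X](subrr (1 : R)); apply: cvgB; first exact: cvg_cst.
    by rewrite -[X in _ --> X](mulr1 (1 : R)); exact: cvgM.
have fv : ((fun y => (1 + D y)^-1 * (f (v y) : R)) @ F --> (1 * f u : R)).
  by apply: cvgM => //; exact: (uc f cf).
have fy : ((fun y => c y * (f y : R)) @ F --> (0 * f x : R)).
  by apply: cvgM => //; exact: (xc f cf).
have fw : (fun y => f (rebalance (D y) (v y) y) : R) =
    (fun y => (1 + D y)^-1 * (f (v y) : R)) + (fun y => c y * (f y : R)).
  apply/funext => y; rewrite /rebalance linearD.
  by congr (_ + _); rewrite (linearZZ f).
have := cvgD fv fy; rewrite mul1r mul0r addr0 -fw; exact.
Unshelve. all: by end_near. Qed.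

(** * A criterion for the property CWO-S *)

(** What the criterion needs at a point [\sum_j l_j u_j] of norm 1: additivity
    of the norms keeps the average norm of the pieces of [y] at most 1, and
    [phi] bounds the norm of each piece from below, so that together they
    control each norm. *)
Definition norm_additive_splitting n (l : 'I_n -> R) (u : 'I_n -> V)
    (M : 'I_n -> {linear V -> V}) (phi : {linear V -> R^o}) : Prop :=
  [/\ forall j, continuous (M j) /\ M j (\sum_(i < n) l i *: u i) = u j,
      forall y, \sum_(j < n) l j *: M j y = y,
      forall y, \sum_(j < n) l j * `|M j y| = `|y|,
      continuous (phi : V -> R^o) &
      (forall y, phi y <= `|y|) /\ phi (\sum_(j < n) l j *: u j) = 1].

(** For [y] in the ball weakly close to [x], the rebalanced pieces
    of [y] are in the ball and weakly close to the [u_j], hence in the [U_j],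
    and their combination is [y]. *)
Lemma CWO_S_of_splitting :
  (forall n (l : 'I_n -> R) (u : 'I_n -> V),
    (forall j, 0 < l j) -> \sum_(j < n) l j = 1 -> (forall j, `|u j| <= 1) ->
    `|\sum_(j < n) l j *: u j| = 1 ->
    exists (M : 'I_n -> {linear V -> V}) (phi : {linear V -> R^o}),
      norm_additive_splitting l u M phi) ->
  CWO_S V.
Proof.
move=> H n l U l0 l1 oU x [[u uU xE] x1].
rewrite /unit_sphere/= in x1.
have u1 j : `|u j| <= 1 by apply: (oU j).1; exact: uU.
rewrite -xE in x1.
have [M [phi [+ Msum Mnorm cphi [phile phix]]]] := H n l u l0 l1 u1 x1.
rewrite xE in x1 phix * => cM.
rewrite /relative_weak_interior /interior /=.
have x1' : `|x| <= 1 by rewrite x1.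
rewrite [X in X _](nbhs_weak_ball x1').
pose F := within (@unit_ball R V) (nbhs (x : weak_space V)).
have FF : Filter F by exact: within_filter.
have Fx : F --> (x : weak_space V) by exact: cvg_within.
have FB : \forall y \near F, `|y| <= 1 by exact: withinT.
have lin f := (weak_cvgP x FF).1 Fx f.
have Mx j : M j @ F --> (u j : weak_space V).
  apply/weak_cvgP => f cf.
  have := lin (f \o M j); rewrite /= (cM j).2; apply.
  by move=> z; apply: continuous_comp; [exact: (cM j).1|exact: cf].
have phiu : forall j, phi (u j) = 1.
  apply: convex_comb_eq1 l0 l1 _ _ => [j|].
    by rewrite (le_trans (phile _)).
  by rewrite -phix -xE linear_sum; apply: eq_bigr => j _; rewrite linearZ.
have nM j : (fun y => `|M j y|) @ F --> (1 : R).
  have phiM : (fun y => phi (M j y) : R) @ F --> (1 : R).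
    by rewrite -(phiu j); exact: ((weak_cvgP _ _).1 (Mx j) phi cphi).
  have phic : (fun y => phi y : R) @ F --> (1 : R).
    by rewrite -phix; exact: lin cphi.
  (* The terms [l_i * (|M_i y| - phi (M_i y))] are nonnegative with sum
     [|y| - phi y], so each of them is at most [1 - phi y]. *)
  apply: (@squeeze_cvgr _ _ _ _ (fun y => phi (M j y))
     (fun y => (phi (M j y) : R) + (l j)^-1 * (1 - (phi y : R)))).
  - near=> y.
    have y1 : `|y| <= 1 by near: y.
    rewrite phile /= -lerBlDl -(ler_pM2l (l0 j)) mulVKf ?gt_eqF//.
    have s : \sum_(i < n) l i * (`|M i y| - phi (M i y)) = `|y| - phi y.
      under eq_bigr do rewrite mulrBr.
      rewrite sumrB Mnorm; congr (_ - _); rewrite -[in RHS](Msum y) linear_sum.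
      by apply: eq_bigr => i _; rewrite linearZ.
    apply: (@le_trans _ _ (`|y| - phi y)); last by rewrite lerD2r.
    rewrite -s (bigD1 j)//= lerDl sumr_ge0// => i _.
    by rewrite mulr_ge0 ?(ltW (l0 i))// subr_ge0.
  - by [].
  - rewrite [X in _ --> X](_ : _ = 1 + (l j)^-1 * (1 - 1)); last first.
      by rewrite subrr mulr0 addr0.
    apply: cvgD => //; apply: cvgM; first exact: cvg_cst.
    by apply: cvgB => //; exact: cvg_cst.
(* A sum rather than a maximum of deviations: it bounds each of them and its
   limit is immediate. *)
pose D y := \sum_(j < n) `| `|M j y| - 1 |.
have D0 y : 0 <= D y by exact: sumr_ge0.
have MD j y : `|M j y| <= 1 + D y.
  rewrite -lerBlDl (le_trans (ler_norm _))// /D (bigD1 j)//= lerDl.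
  exact: sumr_ge0.
have Dc : D @ F --> (0 : R).
  rewrite [X in _ --> X](_ : _ = \sum_(j < n) `|1 - 1|); last first.
    by rewrite big1// => j _; rewrite subrr normr0.
  apply: cvg_big => [|j _]; first exact: add_continuous.
  by apply: cvg_norm; apply: cvgB => //; exact: cvg_cst.
have vU : \forall y \near F, forall j, U j (rebalance (D y) (M j y) y).
  apply: filter_forall => j.
  have : nbhs (u j : weak_ball V) (U j).
    by apply: open_nbhs_nbhs; split; [exact: (oU j).2|exact: uU].
  rewrite [X in X _](nbhs_weak_ball (u1 j)) => Uj.
  have Fc : (fun y => rebalance (D y) (M j y) y) @ F --> (u j : weak_space V).
    apply: rebalance_cvg FB _ _ Dc (nM j) Fx (Mx j); exact: filterE.
  have h := Fc _ Uj.
  near=> y; have y1 : `|y| <= 1 by near: y.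
  have := norm_rebalance (D0 y) (MD j y) y1.
  by near: y; exact: h.
change (F (convex_combination_of_sets l U)).
near=> y; have y1 : `|y| <= 1 by near: y.
have Uy : forall j, U j (rebalance (D y) (M j y) y) by near: y; exact: vU.
exists (fun j => rebalance (D y) (M j y) y) => //.
exact: sum_rebalance.
Unshelve. all: by end_near. Qed.

End weak.

(** * Operators and functionals on L1 *)

Lemma bounded_linear_operator_continuous (R : realType) (V W : normedModType R)
  (f : {linear V -> W}) (K : R) : (forall y, `|f y| <= K * `|y|) -> continuous f.
Proof.
move=> fK; apply/linear_bounded_continuous/linear_boundedP.
near=> r => y; rewrite (le_trans (fK y))// ler_wpM2r//.
Unshelve. all: by end_near. Qed.

Section L1.
Context d (T : measurableType d) (R : realType).
Variable mu : {measure set T -> \bar R}.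
Local Notation L1 := (LspaceType1 mu).

Implicit Types (x y : L1) (g : T -> R).

Lemma L1_integrable y : mu.-integrable setT (EFin \o (y : T -> R)).
Proof. exact/Lfun1_integrable/Lspace_Lfun. Qed.

Lemma measurable_L1 y : measurable_fun setT (y : T -> R).
Proof. by have /measurable_int/measurable_EFinP := L1_integrable y. Qed.

Lemma norm_L1E y : `|y| = \int[mu]_t `|(y : T -> R) t|.
Proof. by rewrite {1}/Num.norm/= /Lspace_norm Lnorm1. Qed.

Lemma Rintegral_ae_eq (f g : T -> R) : measurable_fun setT f ->
  measurable_fun setT g -> f = g %[ae mu] ->
  \int[mu]_t f t = \int[mu]_t g t.
Proof.
move=> mf mg fg; congr fine; apply: ae_eq_integral => //; try exact/measurable_EFinP.
by apply: filterS fg => t h Dt; rewrite h.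
Qed.

Lemma integrable_mulr_bounded g (K : R) y :
  measurable_fun setT g -> (forall t, `|g t| <= K) ->
  mu.-integrable setT (EFin \o (fun t => g t * (y : T -> R) t)).
Proof.
move=> mg gK; apply: (@le_integrable _ _ _ _ _ _ _ (EFin \o (fun t => K * (y : T -> R) t))) => //.
- apply/measurable_EFinP; apply: measurable_funM => //; exact: measurable_L1.
- move=> t _ /=; rewrite lee_fin !normrM ler_wpM2r//.
  by rewrite (le_trans (gK t))// ler_norm.
- have := @integrableZl _ _ _ mu setT measurableT K _ (L1_integrable y).
  by apply: eq_integrable.
Qed.

Definition L1_mul g (K : R) (mg : measurable_fun setT g)
    (gK : forall t, `|g t| <= K) y : L1 :=
  Lclass (Lfun_Sub (lexx 1%E) (iffRL (Lfun1_integrable _ _) (integrable_mulr_bounded y mg gK))).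

Lemma L1_mulE g K (mg : measurable_fun setT g) (gK : forall t, `|g t| <= K) y :
  (L1_mul mg gK y : T -> R) = (fun t => g t * (y : T -> R) t) %[ae mu].
Proof. by apply: ae_eq_trans (LclassE _) _; exact: ae_eq_refl. Qed.

Lemma L1_addE x y :
  ((x + y : L1) : T -> R) = (fun t => (x : T -> R) t + (y : T -> R) t) %[ae mu].
Proof. by apply: ae_eq_trans (LclassE _) _; exact: ae_eq_refl. Qed.

Lemma L1_scaleE (a : R) y :
  ((a *: y : L1) : T -> R) = (fun t => a * (y : T -> R) t) %[ae mu].
Proof. by apply: ae_eq_trans (LclassE _) _; exact: ae_eq_refl. Qed.

Lemma L1_sumE n (y : 'I_n -> L1) :
  ((\sum_(j < n) y j : L1) : T -> R) =
    (fun t => \sum_(j < n) (y j : T -> R) t) %[ae mu].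
Proof.
elim: n y => [|n IH] y.
  rewrite big_ord0; apply: ae_eq_trans (LclassE _) _.
  by apply: aeW => t _ /=; rewrite big_ord0.
rewrite big_ord_recr /=; have := IH (fun j => y (widen_ord (leqnSn n) j)).
move: (L1_addE (\sum_(j < n) y (widen_ord (leqnSn n) j)) (y ord_max)).
apply: filterS2 => t h1 h2 _; rewrite h1// h2// big_ord_recr//.
Qed.

Lemma L1_mul_linear g K (mg : measurable_fun setT g) (gK : forall t, `|g t| <= K) :
  linear (L1_mul mg gK).
Proof.
move=> a x y; apply/Lspace_eqP.
have h1 := L1_mulE mg gK x; have h2 := L1_mulE mg gK y.
have h3 := L1_mulE mg gK (a *: x + y).
have h4 := L1_addE (a *: x) y; have h5 := L1_scaleE a x.
have h6 := L1_addE (a *: L1_mul mg gK x) (L1_mul mg gK y).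
have h7 := L1_scaleE a (L1_mul mg gK x).
near=> t => Dt.
rewrite (near h3 t)// (near h6 t)// (near h7 t)// (near h4 t)//.
rewrite (near h5 t)// (near h1 t)// (near h2 t)//; ring.
Unshelve. all: by end_near. Qed.

Lemma L1_mul_norm_le g K (mg : measurable_fun setT g) (gK : forall t, `|g t| <= K) y :
  `|L1_mul mg gK y| <= K * `|y|.
Proof.
rewrite !norm_L1E -RintegralZl//; last exact: (integrable_norm (L1_integrable y)).
rewrite (@Rintegral_ae_eq _ (fun t => `|g t * (y : T -> R) t|)); first last.
- by apply: filterS (L1_mulE mg gK y) => t h /h ->.
- apply: measurableT_comp => //; apply: measurable_funM => //; exact: measurable_L1.
- apply: measurableT_comp => //; exact: measurable_L1.
apply: le_Rintegral => //.
- exact: (integrable_norm (integrable_mulr_bounded y mg gK)).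
- have := @integrableZl _ _ _ mu setT measurableT K _ (integrable_norm (L1_integrable y)).
  by apply: eq_integrable.
- by move=> t _; rewrite normrM ler_wpM2r.
Qed.

Lemma bounded_multiplier g K : measurable_fun setT g -> (forall t, `|g t| <= K) ->
  exists M : {linear L1 -> L1}, continuous (M : L1 -> L1) /\
    forall y, (M y : T -> R) = (fun t => g t * (y : T -> R) t) %[ae mu].
Proof.
move=> mg gK.
pose M : {linear L1 -> L1} :=
  HB.pack (L1_mul mg gK) (GRing.isLinear.Build R L1 L1 _ _ (L1_mul_linear mg gK)).
exists M; split; last exact: L1_mulE.
exact: (@bounded_linear_operator_continuous _ _ _ M K (L1_mul_norm_le mg gK)).
Qed.

Lemma L1_integral : exists I : {linear L1 -> R^o},
  continuous (I : L1 -> R^o) /\ forall y, I y = \int[mu]_t (y : T -> R) t.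
Proof.
pose i y : R^o := \int[mu]_t (y : T -> R) t.
have li : linear i.
  move=> a x y; rewrite /i.
  rewrite (@Rintegral_ae_eq _ (fun t => a * (x : T -> R) t + (y : T -> R) t)).
  - rewrite RintegralD// ?RintegralZl//; try exact: L1_integrable.
    have := @integrableZl _ _ _ mu setT measurableT a _ (L1_integrable x).
    by apply: eq_integrable.
  - exact: measurable_L1.
  - apply: measurable_funD; last exact: measurable_L1.
    by apply: measurable_funM => //; exact: measurable_L1.
  - have h1 := L1_addE (a *: x) y; have h2 := L1_scaleE a x.
    by near=> t => Dt; rewrite (near h1 t)// (near h2 t).
pose I : {linear L1 -> R^o} := HB.pack i (GRing.isLinear.Build R L1 R^o _ _ li).
exists I; split => //.
apply: (@bounded_linear_operator_continuous _ _ _ I 1) => y.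
rewrite mul1r norm_L1E; apply: le_normr_Rintegral => //; exact: L1_integrable.
Unshelve. all: by end_near. Qed.

Lemma L1_abs y : exists z : L1,
  (z : T -> R) = (fun t => `|(y : T -> R) t|) %[ae mu].
Proof.
exists (Lclass (Lfun_Sub (lexx 1%E) (Lfun_norm (Lspace_Lfun y)))).
by apply: ae_eq_trans (LclassE _) _; exact: ae_eq_refl.
Qed.

(** Naming a representative of [|y|] as an element of L1 turns norms into values
    of the linear integral functional. *)
Lemma norm_L1_ae y (z : L1) : (z : T -> R) = (fun t => `|(y : T -> R) t|) %[ae mu] ->
  `|y| = \int[mu]_t (z : T -> R) t.
Proof.
move=> zy; rewrite norm_L1E; apply: Rintegral_ae_eq => //; last exact: ae_eq_sym.
- by apply: measurableT_comp => //; exact: measurable_L1.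
- exact: measurable_L1.
Qed.

(** The difference of [|y|] and [s y] is nonnegative, so its L1-norm is its
    integral, [|y| - \int s y <= 0]. *)
Lemma norming_sign s y (v : L1) : (forall t, `|s t| = 1) ->
  (v : T -> R) = (fun t => s t * (y : T -> R) t) %[ae mu] ->
  `|y| <= \int[mu]_t (v : T -> R) t ->
  (fun t => `|(y : T -> R) t|) = (fun t => s t * (y : T -> R) t) %[ae mu].
Proof.
move=> s1 vE le; have [z zE] := L1_abs y; have [I [_ IE]] := L1_integral.
have h1 := L1_addE z (- 1 *: v); have h2 := L1_scaleE (- 1) v.
pose w := z + (- 1) *: v.
have wE : (w : T -> R) = (fun t => `|(w : T -> R) t|) %[ae mu].
  near=> t => Dt.
  rewrite (near h1 t)// (near h2 t)// (near zE t)// (near vE t)//.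
  rewrite [RHS]ger0_norm// mulN1r subr_ge0.
  by rewrite (le_trans (ler_norm _))// normrM s1 mul1r.
have w0 : w = 0.
  apply/eqP; rewrite -normr_le0 (norm_L1_ae wE) -IE /w scaleN1r linearB !IE.
  by rewrite -(norm_L1_ae zE) subr_le0.
have zv : z = v by apply/eqP; rewrite -subr_eq0 -scaleN1r -/w w0.
rewrite zv in zE; exact: ae_eq_trans (ae_eq_sym zE) vE.
Unshelve. all: by end_near. Qed.

(** * Splitting L1 along a convex combination of norm one *)

(** The [u_j] have the sign of their combination [x], so multiplying [x] by the
    shares of the [|u_j|] recovers them.  The shares are nonnegative with
    weighted sum 1, so multiplying by them splits [y] and [|y|] alike. *)
Lemma L1_splitting n (l : 'I_n -> R) (u : 'I_n -> L1) :
    (forall j, 0 < l j) -> \sum_(j < n) l j = 1 -> (forall j, `|u j| <= 1) ->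
    `|\sum_(j < n) l j *: u j| = 1 ->
    exists (M : 'I_n -> {linear L1 -> L1}) (phi : {linear L1 -> R^o}),
      norm_additive_splitting l u M phi.
Proof.
move=> l0 l1 u1; set x := \sum_(j < n) l j *: u j => x1.
(* The value 1 at the zeros of [x] makes [s] unimodular, so that multiplication
   by [s] preserves the norm and [s * s = 1] everywhere. *)
pose s t : R := if 0 <= (x : T -> R) t then 1 else -1.
have s1 t : `|s t| = 1 by rewrite /s; case: ifP; rewrite ?normrN normr1.
have sx t : s t * (x : T -> R) t = `|(x : T -> R) t|.
  rewrite /s; case: ifPn => [h|]; first by rewrite mul1r ger0_norm.
  by rewrite -ltNge => h; rewrite mulN1r ltr0_norm.
have ms : measurable_fun setT s.
  apply: measurable_fun_ifT => //; apply: measurable_fun_ler => //.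
  exact: measurable_L1.
have [S [cS SE]] : exists M : {linear L1 -> L1}, continuous (M : L1 -> L1) /\
    forall y, (M y : T -> R) = (fun t => s t * (y : T -> R) t) %[ae mu].
  by apply: (@bounded_multiplier _ 1) => // t; rewrite s1.
have [I [cI IE]] := L1_integral.
have Ile y : I y <= `|y|.
  rewrite IE norm_L1E (le_trans (ler_norm _))// le_normr_Rintegral//.
  exact: L1_integrable.
have nS y : `|S y| = `|y|.
  have [z zh] := L1_abs y; rewrite (norm_L1_ae zh); apply: norm_L1_ae.
  have h := SE y; near=> t => Dt.
  by rewrite (near zh t)// (near h t)// normrM s1 mul1r.
pose phi : {linear L1 -> R^o} := I \o S.
have phile y : phi y <= `|y| by rewrite -(nS y); exact: Ile.
have phix : phi x = 1.
  rewrite -[RHS]x1 /phi/= IE; apply/esym/norm_L1_ae.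
  have h := SE x; near=> t => Dt.
  by rewrite (near h t).
have phiu : forall j, phi (u j) = 1.
  apply: convex_comb_eq1 l0 l1 _ _ => [j|]; first by rewrite (le_trans (phile _)).
  by rewrite -[RHS]phix /x linear_sum; apply: eq_bigr => j _; rewrite linearZ.
have uE : \forall t \ae mu, forall j, `|(u j : T -> R) t| = s t * (u j : T -> R) t.
  apply: filter_forall => j.
  have : `|u j| <= \int[mu]_t (S (u j) : T -> R) t.
    by rewrite -IE (le_trans (u1 j))// -[leLHS](phiu j).
  by move/(norming_sign s1 (SE _)); apply: filterS => t; exact.
pose g j t := share l (fun i => `|(u i : T -> R) t|) j.
have /choice[M MP] j : exists M : {linear L1 -> L1},
    continuous (M : L1 -> L1) /\
    forall y, (M y : T -> R) = (fun t => g j t * (y : T -> R) t) %[ae mu].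
  apply: (@bounded_multiplier _ (l j)^-1) => [|t].
  - pose w t := \sum_(i < n) l i * `|(u i : T -> R) t|.
    have mu_ i : measurable_fun setT (fun t => `|(u i : T -> R) t|).
      by apply: measurableT_comp => //; exact: measurable_L1.
    have mw : measurable_fun setT w.
      by apply: measurable_sum => i; exact: measurable_funM.
    apply: measurable_fun_ifT => //; first exact: measurable_fun_eqr.
    apply: measurable_funM => //.
    (* The inverse is written as a power to use measurability of powers. *)
    rewrite (_ : (fun _ => _) = (fun t => w t `^ (-1))).
      exact: (measurableT_comp (measurable_powR _)).
    apply/funext => t; rewrite powR_inv1// /w sumr_ge0// => i _.
    by rewrite mulr_ge0// ltW.
  - by rewrite ger0_norm ?share_ge0 ?share_le.
have Msum y : \sum_(j < n) l j *: M j y = y.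
  apply/Lspace_eqP.
  have h1 := L1_sumE (fun j => l j *: M j y).
  have h2 : \forall t \ae mu, forall j, ((l j *: M j y : L1) : T -> R) t =
      l j * (g j t * (y : T -> R) t).
    apply: filter_forall => j; have h3 := L1_scaleE (l j) (M j y).
    have h4 := (MP j).2 y.
    by near=> t; rewrite (near h3 t)// (near h4 t).
  near=> t => Dt; rewrite (near h1 t)//.
  under eq_bigr do rewrite (near h2 t)// mulrA.
  by rewrite -mulr_suml sum_share// mul1r.
exists M, phi; split => //.
- move=> j; split; first exact: (MP j).1.
  apply/Lspace_eqP; have h1 := (MP j).2 x.
  have h2 := L1_sumE (fun j => l j *: u j).
  have h3 : \forall t \ae mu, forall j, ((l j *: u j : L1) : T -> R) t =
      l j * (u j : T -> R) t.
    apply: filter_forall => i; have h4 := L1_scaleE (l i) (u i).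
    by near=> t; rewrite (near h4 t).
  near=> t => Dt; rewrite (near h1 t)// [X in _ * X](near h2 t)//.
  under eq_bigr do rewrite (near h3 t)//.
  apply: (@share_sum _ _ _ _ _ (s t)) => //; first by near: t.
  by rewrite /s; case: ifP => _; rewrite ?mulr1// mulrNN mulr1.
- move=> y; have [z zh] := L1_abs y.
  rewrite [RHS](norm_L1_ae zh) -[in RHS](Msum z) -IE linear_sum.
  apply: eq_bigr => j _; rewrite linearZ/= IE; congr (_ * _).
  apply: norm_L1_ae; have h1 := (MP j).2 y; have h2 := (MP j).2 z.
  near=> t => Dt; rewrite (near h2 t)// (near h1 t)// (near zh t)// normrM.
  by rewrite (@ger0_norm _ (g j t))// share_ge0.
- by move=> y; apply: continuous_comp; [exact: cS|exact: cI].
Unshelve. all: by end_near. Qed.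

End L1.

Theorem theorem5p5 (d : measure_display) (T : measurableType d) (R : realType)
    (mu : {sigma_finite_measure set T -> \bar R})
    (mu_neq0 : exists2 A : set T, measurable A & mu A != 0%E) :
  CWO_S (LspaceType1 mu).
Proof. by apply: CWO_S_of_splitting => n l u; exact: L1_splitting. Qed.
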